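(* Let $p$ be a prime, $G$ an extraspecial $p$-group, and $i_G$ the number of word image impostors in $G$. (i) If $p=2$, then $i_G=1$ if $G$ is isomorphic to the quaternion group $Q_2$ of order $8$, and $i_G=5$ otherwise. (ii) If $p$ is odd, then $i_G=1$ if $\exp(G)=p$; $i_G=2^{p+1}-3$ if $\exp(G)=p^2$ and $|G|=p^3$; and $i_G=2^{p+2}-3$ if $\exp(G)=p^2$ and $|G|>p^3$.
   Context: A special $p$-group is a finite $p$-group whose center, derived subgroup and Frattini subgroup coincide and are elementary abelian; it is extraspecial if $|Z(G)|=p$. $F_d$ is the free group on $d$ letters; for $w\in F_d$, $w(G)$ is the image of the word map $G^d\to G$. A word image candidate is a subset $A\subseteq G$ with $1\in A$ and $\varphi(A)\subseteq A$ for all $\varphi\in\mathrm{Aut}(G)$. A word image impostor is a word image candidate that is not equal to $w(G)$ for any $d\ge1$, $w\in F_d$. *)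

(* Defs.v *)
From mathcomp Require Import all_boot all_fingroup all_solvable.
Set Implicit Arguments. Unset Strict Implicit. Unset Printing Implicit Defensive.
Import GroupScope.

(* A word in the free group F_d: a (not necessarily reduced) sequence of
   letters x_i^{+1} (false) or x_i^{-1} (true), i : 'I_d.  Every element of
   F_d is represented by such a sequence and equal group elements induce
   equal word maps. *)
Definition word (d : nat) := seq ('I_d * bool).

Definition eval_word (gT : finGroupType) d (w : word d) (x : 'I_d -> gT) : gT :=
  foldr (fun l acc => (if l.2 then (x l.1)^-1 else x l.1) * acc) 1 w.

Definition word_image (gT : finGroupType) (G : {group gT}) d (w : word d)
  : {set gT} :=
  [set eval_word w (fun i => (x : {ffun 'I_d -> gT}) i) |
     x in [set x : {ffun 'I_d -> gT} | [forall i, x i \in G]]].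

Definition is_word_image (gT : finGroupType) (G : {group gT}) (A : {set gT})
  : Prop :=
  exists (d : nat) (w : word d), 0 < d /\ word_image G w = A.

Definition word_image_candidate (gT : finGroupType) (G : {group gT})
  (A : {set gT}) : Prop :=
  A \subset G /\ 1 \in A /\ (forall a, a \in Aut G -> a @: A \subset A).

Definition word_image_impostor (gT : finGroupType) (G : {group gT})
  (A : {set gT}) : Prop :=
  word_image_candidate G A /\ ~ is_word_image G A.

Definition num_impostors_is (gT : finGroupType) (G : {group gT}) (n : nat)
  : Prop :=
  exists S : {set {set gT}}, #|S| = n /\
    (forall A : {set gT}, A \in S <-> word_image_impostor G A).

(* Main.v *)
(* Every candidate contains 1 and is a union of Aut(G)-orbits, so there are 2^k
   candidates, where k is the number of Aut(G)-orbits on G \ {1}. The word images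
   are exactly 1, Z(G) and G: a word in which some letter has exponent sum prime
   to p is surjective; any other word takes values in Z(G), and its image is
   Aut(G)-invariant while Aut(G) is transitive on Z(G) \ {1}. Hence i_G = 2^k - 3.

   To find the orbits, regard V = G / Z(G) as a symplectic space over F_p, with
   the p-th power map V -> Z(G) (quadratic if p = 2, linear if p is odd).
   Noncommuting x and y with x^p = y^p are exchanged by a transvection along
   x^-1 y; commuting ones are joined through a third element, except that for
   p = 2 a Siegel transformation may be needed. For p odd, "dilations" inducing
   any power map on Z(G) are glued from the factors of order p^3 of a central
   product decomposition. With Omega = Ohm_1(G) and U = C_G(Omega), the orbits on
   G \ {1} are the nonempty ones among:
   - p = 2: Z(G) \ {1}, the noncentral involutions, the elements of order 4;
   - p odd: Z(G) \ {1}, Omega \ U, G \ Omega, and each coset of Z(G) in U other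
     than Z(G), the latter being rigid because commutation with an element of U
     is a fixed multiple of the p-th power map. *)
Require Import Defs.
From mathcomp Require Import all_boot all_fingroup all_solvable.
From mathcomp Require Import zify.
Set Implicit Arguments. Unset Strict Implicit. Unset Printing Implicit Defensive.
Import GroupScope.

(** The quadratic function n |-> ['C(n, 2)] has polar form mn; this is what absorbs the commutator
    term in a transvection. *)
Lemma bin2D m n : 'C(m + n, 2) = ('C(m, 2) + 'C(n, 2) + m * n)%N.
Proof.
elim: m => [|m IHm]; first by rewrite add0n mul0n addn0.
by rewrite addSn !binS IHm !bin1; lia.
Qed.

(** Reordering for the crossed homomorphism of the Siegel map, with [c] the central commutator
    correction. *)
Lemma commute_shuffle (gT : finGroupType) (s1 s2 v1 v2 z1 z2 c : gT) :
    commute v1 s2 -> commute (z1 * c) (s2 * v2) -> commute z2 c ->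
  s1 * s2 * (v1 * v2) * (z1 * z2 * c) = s1 * v1 * z1 * c * (s2 * v2 * z2).
Proof.
move=> cvs czsv czc; rewrite -!mulgA czc (mulgA v1) (mulgA z1) (mulgA s2 v2).
by rewrite (mulgA (z1 * c)) czsv !mulgA -(mulgA s1 v1) cvs !mulgA.
Qed.

(** * Automorphisms of extraspecial groups *)

Section Extraspecial.

Variables (gT : finGroupType) (p : nat) (G : {group gT}).
Hypotheses (pG : p.-group G) (esG : extraspecial G).
Implicit Types x y z g h : gT.

Let p_pr : prime p := extraspecial_prime pG esG.
Let oZ : #|'Z(G)| = p := card_center_extraspecial pG esG.
Let sZG : 'Z(G) \subset G := center_sub G.

Lemma extraspecial_comm_center x y : x \in G -> y \in G -> [~ x, y] \in 'Z(G).
Proof. by case: esG => [[_ <-] _]; apply: mem_commg. Qed.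

(** Commutators are central, so commutation is bimultiplicative: it is the symplectic form on G /
    Z(G). *)
Lemma extraspecial_commMg x y g :
  x \in G -> y \in G -> g \in G -> [~ x * y, g] = [~ x, g] * [~ y, g].
Proof.
move=> Gx Gy Gg; rewrite commMgJ conjgE.
by rewrite -(centerC Gy (extraspecial_comm_center Gx Gg)) mulKg.
Qed.

Lemma extraspecial_commgM x y g :
  x \in G -> y \in G -> g \in G -> [~ g, x * y] = [~ g, x] * [~ g, y].
Proof.
move=> Gx Gy Gg; rewrite commgMJ conjgE.
have Zgx := extraspecial_comm_center Gg Gx.
rewrite -(centerC Gy Zgx) mulKg (centerC _ Zgx) //.
by rewrite (subsetP sZG) // extraspecial_comm_center.
Qed.

Lemma extraspecial_commXg x g n :
  x \in G -> g \in G -> [~ x ^+ n, g] = [~ x, g] ^+ n.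
Proof.
move=> Gx Gg; apply: commXg.
exact: (centerC Gx (extraspecial_comm_center Gx Gg)).
Qed.

Lemma extraspecial_commgX x g n :
  x \in G -> g \in G -> [~ g, x ^+ n] = [~ g, x] ^+ n.
Proof.
move=> Gx Gg; apply: commgX.
exact: (centerC Gx (extraspecial_comm_center Gg Gx)).
Qed.

Lemma extraspecial_commZg z g : z \in 'Z(G) -> g \in G -> [~ z, g] = 1.
Proof. by move=> Zz Gg; apply/eqP/commgP/commute_sym/(centerC Gg Zz). Qed.

Lemma extraspecial_expZ z : z \in 'Z(G) -> z ^+ p = 1.
Proof. by move=> Zz; apply/eqP; rewrite -order_dvdn -oZ order_dvdG. Qed.

Lemma extraspecial_orderZ z : z \in 'Z(G) -> z != 1 -> #[z] = p.
Proof. by move=> Zz ntz; apply: nt_prime_order => //; apply: extraspecial_expZ. Qed.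

Lemma extraspecial_cycleZ z : z \in 'Z(G) -> z != 1 -> <[z]> = 'Z(G).
Proof.
move=> Zz ntz; apply/eqP; rewrite eqEcard cycle_subG Zz oZ /=.
by rewrite -orderE extraspecial_orderZ.
Qed.

(** The Frattini subgroup of a p-group contains all p-th powers, and here it is the centre. *)
Lemma extraspecial_expgp x : x \in G -> x ^+ p \in 'Z(G).
Proof.
have [[<- _] _] := esG; rewrite (Phi_joing pG) => Gx.
rewrite mem_gen // inE orbC -{2}(expn1 p) (MhoE 1 pG) mem_gen //.
by apply/imsetP; exists x.
Qed.

(** As [z] generates the centre, the form (a, -) can be written with exponents. These are naturals,
    meaningful only modulo p. *)
Lemma extraspecial_dlog z a :
    z \in 'Z(G) -> z != 1 -> a \in G ->
  exists k : gT -> nat, forall g, g \in G -> z ^+ k g = [~ a, g].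
Proof.
move=> Zz ntz Ga.
apply: (@fin_all_exists _ _ (fun g n => g \in G -> z ^+ n = [~ a, g])) => g.
have [Gg|] := boolP (g \in G); last by exists 0%N.
have: [~ a, g] \in <[z]> by rewrite extraspecial_cycleZ ?extraspecial_comm_center.
by case/cycleP=> n ->; exists n.
Qed.

(** If f x = 1, then f kills the central elements [[~ x, y]], so these are trivial; thus x is
    central, and then trivial itself. *)
Lemma extraspecial_Aut (f : {morphism G >-> gT}) :
    f @* G \subset G -> {in 'Z(G), forall z, f z = 1 -> z = 1} ->
  exists2 a, a \in Aut G & {in G, a =1 f}.
Proof.
move=> sfG injZ; suffices injf: 'injm f.
  have fG: f @* G = G by apply/eqP; rewrite eqEcard sfG card_injm /=.
  by exists (aut injf fG); [apply: Aut_aut | apply: autE].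
apply/subsetP=> x /morphpreP[Gx /set1P fx]; apply/set1P/injZ=> //.
apply/centerP; split=> // y Gy; apply/commgP/eqP/injZ.
  exact: extraspecial_comm_center.
by rewrite morphR // fx comm1g.
Qed.

(* [g |-> g * theta g] is multiplicative exactly when [theta] is a crossed
   homomorphism. *)
Lemma extraspecial_shear (theta : gT -> gT) :
    {in G, forall g, theta g \in G} ->
    {in G &, forall g h, theta (g * h) = theta g ^ h * theta h} ->
    {in 'Z(G), forall z, theta z = 1} ->
  exists2 a, a \in Aut G & {in G, forall g, a g = g * theta g}.
Proof.
move=> Gth thM thZ.
have fM: {in G &, {morph (fun g => g * theta g) : g h / g * h}}.
  by move=> g h Gg Gh /=; rewrite thM // -!mulgA mulKVg.
have [||a AutGa aE] := @extraspecial_Aut (Morphism fM).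
- apply/subsetP=> _ /morphimP[g Gg _ ->] /=; by rewrite groupM // Gth.
- by move=> z Zz /=; rewrite thZ // mulg1.
by exists a => // g Gg; rewrite aE.
Qed.

Lemma extraspecial_modp (F : nat -> gT) z m n :
    (forall i, F (i + p)%N = F i) -> z \in 'Z(G) -> z != 1 ->
  z ^+ m = z ^+ n -> F m = F n.
Proof.
move=> Fp Zz ntz /eqP; rewrite eq_expg_mod_order extraspecial_orderZ // => /eqP mn.
have FM i q : F (q * p + i)%N = F i.
  by elim: q => // q IHq; rewrite mulSn -addnA addnC Fp.
by rewrite (divn_eq m p) (divn_eq n p) !FM mn.
Qed.

(* The symplectic transvection along [a = x^-1 * y], with a central correction
   term coming from the quadratic form n |-> 'C(n, 2). *)
Lemma extraspecial_transvection x y :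
    x \in G -> y \in G -> [~ x, y] != 1 -> x ^+ p = y ^+ p ->
  exists2 a, a \in Aut G & a x = y.
Proof.
move=> Gx Gy ncxy xyp; pose a := x^-1 * y; pose z := [~ a, x].
have Ga : a \in G by rewrite groupM ?groupV.
have Zz : z \in 'Z(G) by apply: extraspecial_comm_center.
have Gz := subsetP sZG z Zz.
have zE : z = [~ y, x].
  rewrite /z extraspecial_commMg ?groupV //.
  by have /commgP/eqP-> : commute x^-1 x; rewrite ?mul1g // /commute mulgV mulVg.
have ntz : z != 1 by rewrite zE -invg_comm eq_invg1.
have [k kE] := extraspecial_dlog Zz ntz Ga.
pose F n := a ^+ n * z ^+ 'C(n, 2).
have FD m n : F (m + n)%N = F m * F n * z ^+ (m * n).
  have cza i j : a ^+ i * z ^+ j = z ^+ j * a ^+ i.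
    by apply: commuteX2; apply: (centerC Ga).
  rewrite /F bin2D !expgD !mulgA; congr (_ * _ * _).
  by rewrite -!mulgA cza.
(* Collection gives a^p = x^-p y^p z^-C with C = ['C(p, 2)]. The hypothesis cancels the p-th powers
   and the correction in [F] cancels z^-C; this also covers p = 2. *)
have Fp : F p = 1.
  have xVy : [~ y, x^-1] = z^-1.
    apply/eqP; rewrite eq_sym eq_invg_mul zE -extraspecial_commgM ?groupV //.
    by rewrite mulgV commg1.
  have cZ u v w : u \in G -> v \in G -> w \in G -> commute u [~ v, w].
    by move=> Gu Gv Gw; apply: (centerC Gu); apply: extraspecial_comm_center.
  rewrite /F /a expMg_Rmul; [|apply: cZ; rewrite ?groupV..] => //.
  by rewrite xVy !expgVn xyp mulVg mul1g mulVg.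
have Fper i : F (i + p)%N = F i.
  by rewrite FD Fp mulg1 mulnC expgM extraspecial_expZ // expg1n mulg1.
have GF n : F n \in G by rewrite groupM ?groupX.
have [|g h Gg Gh|u Zu|b AutGb bE] := @extraspecial_shear (F \o k).
- by move=> g _; apply: GF.
- rewrite /= (@extraspecial_modp F z (k (g * h)) (k g + k h)) //; last first.
    by rewrite expgD !kE ?groupM // extraspecial_commgM.
  have -> : F (k g) ^ h = F (k g) * z ^+ (k g * k h).
    rewrite conjg_mulR extraspecial_commMg ?groupX // extraspecial_commXg //.
    rewrite (extraspecial_commZg (groupX _ Zz)) // mulg1.
    by rewrite (mulnC (k g)) (expgM z) kE.
  rewrite FD -[LHS]mulgA -[RHS]mulgA; congr (_ * _).
  by rewrite (centerC (GF _)) ?groupX.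
- rewrite /= (@extraspecial_modp F z (k u) 0) //; first exact: mulg1.
  rewrite kE ?(subsetP sZG) //.
  by rewrite -invg_comm extraspecial_commZg // invg1.
(* Since [a, x] = z, the exponent [k x] is 1 modulo p, and F 1 = a sends x to x a = y. *)
exists b => //; rewrite bE //= (@extraspecial_modp F z (k x) 1) ?kE //.
by rewrite /F mulg1 mulKVg.
Qed.

(* The symplectic map [w |-> w + (w, v) s + (w, s) v]. *)
Lemma extraspecial_siegel x s v :
    x \in G -> s \in G -> v \in G -> s ^+ p = 1 -> v ^+ p = 1 ->
    commute s v -> commute s x -> [~ v, x] != 1 ->
  exists2 a, a \in Aut G & a x = x * s.
Proof.
move=> Gx Gs Gv sp vp csv csx ntz; set z := [~ v, x] in ntz.
have Zz : z \in 'Z(G) by apply: extraspecial_comm_center.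
have Gz := subsetP sZG z Zz.
have [ks ksE] := extraspecial_dlog Zz ntz Gs.
have [kv kvE] := extraspecial_dlog Zz ntz Gv.
have per (u : gT) m n : u ^+ p = 1 -> z ^+ m = z ^+ n -> u ^+ m = u ^+ n.
  move=> up; apply: (extraspecial_modp (F := fun i => u ^+ i) _ Zz ntz) => i.
  by rewrite expgD up mulg1.
have zp := extraspecial_expZ Zz.
(* The bilinear defect of the product of [ks] and [kv] is the exponent of the commutator of
   [theta g] with h, so the central factor makes [theta] a crossed homomorphism. *)
pose theta g := s ^+ kv g * v ^+ ks g * z ^+ (ks g * kv g).
have cz g n : g \in G -> commute g (z ^+ n).
  by move=> Gg; apply: (centerC Gg); apply: groupX.
have [g Gg|g h Gg Gh|u Zu|b AutGb bE] := @extraspecial_shear theta.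
- by rewrite !groupM ?groupX.
- have Ds : z ^+ ks (g * h) = z ^+ (ks g + ks h).
    by rewrite expgD !ksE ?groupM // extraspecial_commgM.
  have Dv : z ^+ kv (g * h) = z ^+ (kv g + kv h).
    by rewrite expgD !kvE ?groupM // extraspecial_commgM.
  have -> : theta g ^ h = theta g * z ^+ (kv g * ks h + ks g * kv h).
    rewrite conjg_mulR; congr (_ * _).
    rewrite /theta !extraspecial_commMg ?groupM ?groupX // !extraspecial_commXg //.
    rewrite (extraspecial_commZg Zz) // expg1n mulg1 -ksE // -kvE //.
    by rewrite -!expgM -expgD mulnC (mulnC (ks g)) (mulnC (kv g)) mulnC.
  have -> : theta (g * h)
      = s ^+ (kv g + kv h) * v ^+ (ks g + ks h)
          * z ^+ ((ks g + ks h) * (kv g + kv h)).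
    rewrite /theta (per s _ _ sp Dv) (per v _ _ vp Ds); congr (_ * _).
    by rewrite expgM Ds -!expgM mulnC expgM Dv -expgM mulnC.
  rewrite /theta (expgD s) (expgD v) mulnDl !mulnDr.
  have -> : (ks g * kv g + ks g * kv h + (ks h * kv g + ks h * kv h)
      = ks g * kv g + ks h * kv h + (kv g * ks h + ks g * kv h))%N by lia.
  rewrite (expgD z (ks g * kv g + ks h * kv h)) (expgD z (ks g * kv g)).
  apply: commute_shuffle.
  - exact/commute_sym/commuteX2.
  - by rewrite -expgD; apply/commute_sym/cz; rewrite groupM ?groupX.
  - exact: commuteX2.
- have kZ (k : gT -> nat) w : w \in G -> z ^+ k u = [~ w, u] -> z ^+ k u = z ^+ 0.
    by move=> Gw ->; rewrite -invg_comm extraspecial_commZg // invg1.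
  have Gu := subsetP sZG u Zu.
  have s0 := kZ _ _ Gs (ksE u Gu); have v0 := kZ _ _ Gv (kvE u Gu).
  by rewrite /theta (per s _ _ sp v0) (per v _ _ vp s0) expgM s0 expg1n !mulg1.
(* At x the exponents are 0 for [ks] and 1 for [kv], so theta x = s. *)
exists b => //; rewrite bE // /theta.
have s0 : z ^+ ks x = z ^+ 0 by rewrite ksE //; apply/eqP/commgP.
have v1 : z ^+ kv x = z ^+ 1 by rewrite kvE.
by rewrite (per s _ _ sp v1) (per v _ _ vp s0) expgM s0 expg1n !mulg1.
Qed.

End Extraspecial.

(* [E] splits as [A ><| <[y]>] with [A] abelian containing the centre and [y] of
   order [p]; raise [A] to the power [m] and fix [y]. *)
Lemma p3group_dilation (gT : finGroupType) (p : nat) (E : {group gT}) m :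
    prime p -> odd p -> #|E| = (p ^ 3)%N -> #|'Z(E)| = p ->
  exists2 f : {morphism E >-> gT},
    f @* E \subset E & {in 'Z(E), forall z, f z = z ^+ m}.
Proof.
move=> p_pr p_odd oE oZ; have p_gt1 := prime_gt1 p_pr.
have esE := card_p3group_extraspecial p_pr oE oZ.
have pE : p.-group E by rewrite /pgroup oE pnatX pnat_id.
have [|expY iY _] := Ohm1_extraspecial_odd pE esE; first by rewrite oE oddX p_odd.
(* ['Ohm_1(E)] has index dividing p; inside the centre it would force |E| to be at most p^2. *)
have [y Yy notZy] : exists2 y, y \in 'Ohm_1(E) & y \notin 'Z(E).
  apply/subsetPn/negP=> sYZ; have := dvdn_leq (ltnW p_gt1) iY.
  apply/negP; rewrite -ltnNge -(@ltn_pmul2l #|'Ohm_1(E)|) // (Lagrange (Ohm_sub 1 E)).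
  rewrite oE; apply: (@leq_ltn_trans (p * p)); first by rewrite leq_mul2r -{2}oZ subset_leq_card ?orbT.
  by rewrite (ltn_exp2l 2 3).
have Ey := subsetP (Ohm_sub 1 E) y Yy.
have yp : y ^+ p = 1 by rewrite -expY expg_exponent.
(* The abelian factor A is the centralizer of an x not commuting with y: it is maximal, so of order
   p^2, and misses y. *)
have [x Ex ncxy] : exists2 x, x \in E & y \notin 'C[x].
  apply/exists_inP; rewrite -negb_forall_in; apply: contra notZy => /forall_inP cEy.
  by apply/centerP; split=> // x /cEy /cent1P.
have notZx : x \notin 'Z(E).
  apply: contra ncxy => /centerP[_ cEx]; by apply/cent1P; rewrite /commute cEx.
have maxA := cent1_extraspecial_maximal esE Ex notZx.
have nsA := p_maximal_normal pE maxA.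
have iA := p_maximal_index pE maxA.
have sAE : 'C_E[x] \subset E := subsetIl _ _.
have oA : #|'C_E[x]| = (p ^ 2)%N.
  apply/eqP; rewrite -(eqn_pmul2r (ltnW p_gt1)) -expnSr -oE.
  by rewrite -(Lagrange sAE) iA.
have cAA : abelian 'C_E[x] by apply: card_p2group_abelian oA.
have notAy : y \notin 'C_E[x] by rewrite inE negb_and ncxy orbT.
have oy : #[y] = p.
  apply: nt_prime_order => //; apply: contra notAy => /eqP->; exact: group1.
have defE : 'C_E[x] ><| <[y]> = E.
  rewrite sdprodE ?(subset_trans _ (normal_norm nsA)) ?cycle_subG //.
    by rewrite (mulg_normal_maximal nsA) ?cycle_subG.
  by rewrite setIC prime_TIg -?orderE ?oy ?cycle_subG.
have powM : {in 'C_E[x] &, {morph (fun a => a ^+ m) : a b / a * b}}.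
  by move=> a b Aa Ab /=; rewrite expgMn //; exact: (centsP cAA).
have actf : {in 'C_E[x] & <[y]>, morph_act 'J 'J (Morphism powM) (idm <[y]>)}.
  by move=> a b _ _ /=; rewrite conjXg.
exists (sdprodm_morphism defE actf).
  rewrite im_sdprodm mul_subG //.
    apply/subsetP=> _ /morphimP[a _ Aa ->] /=; apply/groupX; exact: subsetP Aa.
  by rewrite morphim_idm // cycle_subG.
move=> z /centerP[Ez cEz] /=; rewrite sdprodmEl //.
by rewrite inE Ez; apply/cent1P; rewrite /commute cEz.
Qed.

(** * Automorphisms acting on the centre, for odd p *)

Section Dilation.

Variables (gT : finGroupType) (p : nat) (G : {group gT}).
Hypotheses (pG : p.-group G) (esG : extraspecial G).

Lemma extraspecial_dilation z t :
    odd p -> z \in 'Z(G) -> z != 1 -> t \in 'Z(G) -> t != 1 ->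
  exists2 a, a \in Aut G & a z = t.
Proof.
move=> p_odd Zz ntz Zt ntt; have p_pr := extraspecial_prime pG esG.
have oZ := card_center_extraspecial pG esG.
have [m tE] : exists m, t = z ^+ m.
  by apply/cycleP; rewrite (extraspecial_cycleZ pG esG Zz).
suffices [f sfG fE] : exists2 f : {morphism G >-> gT},
    f @* G \subset G & {in 'Z(G), forall u, f u = u ^+ m}.
  have [u Zu|a AutGa aE] := extraspecial_Aut esG sfG.
    have /cycleP[i ->] : u \in <[z]> by rewrite (extraspecial_cycleZ pG esG Zz).
    rewrite fE ?groupX // -expgM mulnC expgM -tE => /eqP.
    rewrite -order_dvdn (extraspecial_orderZ pG esG Zt ntt).
    by rewrite -(extraspecial_orderZ pG esG Zz ntz) order_dvdn => /eqP.
  by exists a => //; rewrite aE ?fE // (subsetP (center_sub G)).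
have [Es p3Es defG] := extraspecial_structure pG esG.
(* The induction runs over partial central products, each still multiplied by Z(G), on which the map
   is fixed from the start. *)
suffices ext (H : {group gT}) : \big[cprod/1]_(E <- Es) E \* 'Z(G) = H ->
    exists2 f : {morphism H >-> gT},
      f @* H \subset H & {in 'Z(G), forall u, f u = u ^+ m}.
  exact: ext defG.
elim: Es H p3Es {defG} => [|E Es IHEs] H /=.
  rewrite big_nil cprod1g => _ <-.
  have powM : {in 'Z(G) &, {morph (fun a => a ^+ m) : a b / a * b}}.
    by move=> a b Aa Ab /=; rewrite expgMn //; exact: (centsP (center_abelian G)).
  exists (Morphism powM) => //.
  by apply/subsetP=> _ /morphimP[a _ Aa ->] /=; apply/groupX.
case/andP=> /andP[/eqP oE /eqP ZE] p3Es.
rewrite big_cons -cprodA => defH.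
have [[_ K _ defK] defHm cEK] := cprodP defH; rewrite defK in defH defHm cEK.
have [fK sfK fKE] := IHEs K p3Es defK.
have [|fE sfE fEE] := p3group_dilation m p_pr p_odd oE; first by rewrite ZE.
have cf : fK @* K \subset 'C(fE @* E).
  exact: subset_trans sfK (subset_trans cEK (centS sfE)).
have sZK : 'Z(G) \subset K by have [[L _ -> _] <- _] := cprodP defK; apply: mulG_subr.
(* K centralizes E, so the overlap lies in Z(E) = Z(G), where both maps are the m-th power. *)
have eqf : {in E :&: K, fE =1 fK}.
  move=> u /setIP[Eu Ku].
  have ZEu : u \in 'Z(E) by rewrite inE Eu (subsetP cEK).
  by rewrite fEE // fKE // -ZE.
exists (cprodm_morphism defH cf eqf).
  by rewrite im_cprodm -defHm mulgSS.
by move=> u Zu /=; rewrite cprodmEr ?fKE // (subsetP sZK).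
Qed.

End Dilation.

(** * Word maps *)

Section Words.

Variables (gT : finGroupType) (G : {group gT}) (d : nat).
Implicit Types (w : word d) (x y : 'I_d -> gT).

Lemma eq_eval_word w x y : x =1 y -> eval_word w x = eval_word w y.
Proof. by move=> eqxy; elim: w => //= l w ->; rewrite eqxy. Qed.

Lemma eval_word_in w x : (forall i, x i \in G) -> eval_word w x \in G.
Proof.
move=> Gx; elim: w => [|[i b] w IHw] /=; first exact: group1.
by rewrite groupM //; case: ifP => _; rewrite ?groupV.
Qed.

Lemma eval_word1 w x : (forall i, x i = 1) -> eval_word w x = 1.
Proof.
by move=> x1; elim: w => //= -[i b] w /= ->; rewrite x1 invg1 if_same mulg1.
Qed.

Lemma eval_word_morph (rT : finGroupType) (f : {morphism G >-> rT}) w x :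
  (forall i, x i \in G) -> f (eval_word w x) = eval_word w (f \o x).
Proof.
move=> Gx; elim: w => [|[i b] w IHw] /=; first exact: morph1.
rewrite morphM ?eval_word_in //; last by case: ifP => _; rewrite ?groupV.
by rewrite IHw; case: ifP => _; rewrite ?morphV.
Qed.

Lemma eval_word_abelian w x y :
    abelian G -> (forall i, x i \in G) -> (forall i, y i \in G) ->
  eval_word w (fun i => x i * y i) = eval_word w x * eval_word w y.
Proof.
move=> cGG Gx Gy; elim: w => [|[i b] w IHw] /=; first by rewrite mulg1.
have cG := centsP cGG; rewrite IHw !mulgA; congr (_ * _).
have -> : (if b then (x i * y i)^-1 else x i * y i)
    = (if b then (x i)^-1 else x i) * (if b then (y i)^-1 else y i).
  by case: b => //; rewrite invMg cG ?groupV.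
rewrite -!mulgA; congr (_ * _); apply: cG; last exact: eval_word_in.
by case: ifP => _; rewrite ?groupV.
Qed.

(** The exponent n is the exponent sum of letter i, an inverse letter counting as |G| - 1 to stay in
    the naturals. *)
Lemma eval_word_single w i : exists n, {in G, forall g,
  eval_word w (fun j => if j == i then g else 1) = g ^+ n}.
Proof.
elim: w => [|[j b] w [n IHw]] /=; first by exists 0%N.
exists ((j == i) * (if b then #|G|.-1 else 1) + n)%N => g Gg /=.
rewrite IHw // expgD; congr (_ * _); case: eqP => _; last by rewrite invg1 if_same.
rewrite mul1n; case: b; last by rewrite expg1.
by apply/eqP; rewrite eq_invg_mul -expgS prednK ?expg_cardG.
Qed.

(** On an abelian group the word map is a homomorphism, so its value at x is the product of its
    values at the components of x. The truncations [t k] add one component at a time. *)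
Lemma eval_word_abelian1 w x :
    abelian G -> (forall i, x i \in G) ->
    (forall i, eval_word w (fun j => if j == i then x i else 1) = 1) ->
  eval_word w x = 1.
Proof.
move=> cGG Gx x1; pose t k (j : 'I_d) := if j < k then x j else 1.
suffices t1 k : k <= d -> eval_word w (t k) = 1.
  by rewrite -[RHS](t1 d) //; apply: eq_eval_word => j; rewrite /t ltn_ord.
elim: k => [_|k IHk ltkd]; first exact: eval_word1.
pose i := Ordinal ltkd.
rewrite -[RHS]mulg1 -{1}(IHk (ltnW ltkd)) -(x1 i) -eval_word_abelian //.
- apply: eq_eval_word => j; rewrite /t ltnS leq_eqVlt -val_eqE /=.
  case: (ltngtP j k) => [||jk]; rewrite ?mulg1 ?mul1g //.
  by congr x; apply: val_inj.
- by move=> j; rewrite /t; case: ifP.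
- by move=> j /=; case: ifP.
Qed.

Lemma word_imageP w (u : gT) :
  reflect (exists2 x : 'I_d -> gT, forall i, x i \in G & u = eval_word w x)
          (u \in word_image G w).
Proof.
apply: (iffP imsetP) => [[x]|[x Gx ->]].
  by rewrite inE => /forallP Gx ->; exists x.
exists (finfun x); first by rewrite inE; apply/forallP=> i; rewrite ffunE.
by apply: eq_eval_word => i; rewrite ffunE.
Qed.

Lemma word_image_sub w : word_image G w \subset G.
Proof. by apply/subsetP=> u /word_imageP[x Gx ->]; apply: eval_word_in. Qed.

Lemma word_image1 w : 1 \in word_image G w.
Proof. by apply/word_imageP; exists (fun=> 1) => //; rewrite eval_word1. Qed.

Lemma word_image_Aut w a u :
  a \in Aut G -> u \in word_image G w -> a u \in word_image G w.
Proof.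
move=> AutGa /word_imageP[x Gx ->]; apply/word_imageP; exists (a \o x).
  by move=> i; apply: Aut_closed.
by rewrite -(autmE AutGa) eval_word_morph.
Qed.

End Words.

(** * Candidates and orbits *)

Section Counting.

Variables (gT : finGroupType) (G : {group gT}).

(** The identity is left out because every candidate contains it. *)
Definition Aut_orbits : {set {set gT}} := orbit 'P (Aut G) @: G^#.

Lemma Aut_orbitP x y :
  reflect (exists2 a, a \in Aut G & a x = y) (y \in orbit 'P (Aut G) x).
Proof. by apply: (iffP orbitP) => -[a]; exists a. Qed.

Lemma Aut_mem_char (H : {group gT}) a x :
  H \char G -> a \in Aut G -> x \in G -> (a x \in H) = (x \in H).
Proof.
move=> chH AutGa Gx; have /charP[sHG chHf] := chH.
have defH := chHf _ (injm_autm AutGa) (im_autm AutGa).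
apply/idP/idP=> [|Hx]; last by rewrite -(autmE AutGa) -{1}defH mem_morphim.
rewrite -(autmE AutGa) -{1}defH => /morphimP[y Gy Hy].
by move/(injmP (injm_autm AutGa))=> ->.
Qed.

Definition candidates : {set {set gT}} :=
  [set A : {set gT} | [&& A \subset G, 1 \in A &
                          [forall a in Aut G, a @: A \subset A]]].

Lemma candidatesP A : reflect (word_image_candidate G A) (A \in candidates).
Proof.
rewrite inE; apply: (iffP and3P) => [[sAG A1 /forall_inP]|[sAG [A1]]] //.
by move/forall_inP.
Qed.

Lemma Aut_orbit_sub x : x \in G^# -> orbit 'P (Aut G) x \subset G^#.
Proof.
case/setD1P=> ntx Gx; apply/subsetP=> _ /Aut_orbitP[a AutGa <-].
rewrite in_setD1 Aut_closed // andbT; apply: contra ntx => /eqP ax1.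
by apply/eqP/(@perm_inj _ a); rewrite ax1 -(autmE AutGa) morph1.
Qed.

(** A set J of orbits gives the candidate [1 |: cover J]. Orbits that meet are equal, so J can be
    recovered; conversely a candidate is 1 together with the orbits of its nontrivial elements. *)
Lemma card_candidates : #|candidates| = (2 ^ #|Aut_orbits|)%N.
Proof.
rewrite -card_powerset; pose f (J : {set {set gT}}) := 1 |: cover J.
have inj_f : {in powerset Aut_orbits &, injective f}.
  suffices half (J K : {set {set gT}}) : J \subset Aut_orbits -> K \subset Aut_orbits ->
      f J = f K -> J \subset K.
    move=> J K /[!powersetE] sJ sK fJK.
    by apply/eqP; rewrite eqEsubset (half J K) ?(half K J).
  move=> sJ sK fJK; apply/subsetP=> B JB.
  have /imsetP[x Gx defB] := subsetP sJ B JB.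
  have xB : x \in B by rewrite defB orbit_refl.
  have : x \in f K by rewrite -fJK !inE; apply/orP; right; apply/bigcupP; exists B.
  case/setU1P=> [x1|]; first by rewrite x1 setD11 in Gx.
  case/bigcupP=> C KC xC; have /imsetP[y _ defC] := subsetP sK C KC.
  suffices -> : B = C by [].
  by rewrite defB defC; apply/orbit_eqP; rewrite -defC.
rewrite -(card_in_imset inj_f); congr #|pred_of_set _|; apply/setP=> A.
apply/candidatesP/imsetP => [[sAG [A1 invA]]|[J]].
  exists (orbit 'P (Aut G) @: A^#); first by rewrite powersetE imsetS ?setSD.
  apply/setP=> x; rewrite !inE; case: eqVneq => [-> //|ntx] /=.
  apply/idP/bigcupP=> [Ax | [_ /imsetP[y /setD1P[_ Ay] ->]]].
    by exists (orbit 'P (Aut G) x); rewrite ?orbit_refl ?imset_f // !inE ntx.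
  by case/Aut_orbitP=> a AutGa <-; apply: subsetP (invA a AutGa) _ _; apply: imset_f.
rewrite powersetE => sJ ->; split; last split; first 2 last.
- move=> a AutGa; apply/subsetP=> _ /imsetP[x Jx ->].
  case/setU1P: Jx => [->|/bigcupP[B JB xB]].
    by rewrite -(autmE AutGa) morph1 setU11.
  apply/setU1P; right; apply/bigcupP; exists B => //.
  have /imsetP[y _ defB] := subsetP sJ B JB; move: xB; rewrite defB.
  case/Aut_orbitP=> b AutGb <-; apply/Aut_orbitP; exists (b * a).
    by rewrite groupM.
  by rewrite permM.
- rewrite subUset sub1G; apply/bigcupsP=> B /(subsetP sJ)/imsetP[x Gx ->].
  exact: subset_trans (Aut_orbit_sub Gx) (subD1set _ _).
- exact: setU11.
Qed.

(** A criterion for a list of invariant, transitive sets to be the orbits. Dropping [set0] lets the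
    list contain cases that are void in some groups. *)
Lemma Aut_orbits_eq (Q : {set {set gT}}) :
    {in G^#, forall g, exists2 B, B \in Q & g \in B} ->
    {in Q, forall B : {set gT}, {in B, forall x, x \in G^#}} ->
    {in Q & Aut G, forall (B : {set gT}) (a : {perm gT}),
      {in B, forall x, a x \in B}} ->
    {in Q, forall B : {set gT},
      {in B &, forall x y, exists2 a, a \in Aut G & a x = y}} ->
  Aut_orbits = Q :\ set0.
Proof.
move=> covQ subQ invQ transQ.
have orbQ B x : B \in Q -> x \in B -> orbit 'P (Aut G) x = B.
  move=> QB Bx; apply/setP=> y; apply/Aut_orbitP/idP=> [[a AutGa <-]|By].
    exact: invQ.
  exact: transQ QB _ _ Bx By.
apply/setP=> B; apply/imsetP/setD1P=> [[x Gx ->]|[ntB QB]].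
  have [B' QB' B'x] := covQ x Gx; rewrite (orbQ B') //; split=> //.
  by apply/set0Pn; exists x.
have /set0Pn[x Bx] := ntB; exists x; first exact: subQ QB x Bx.
by rewrite (orbQ B).
Qed.

End Counting.

(** * Word images of an extraspecial group *)

Section AutExtraspecial.

Variables (gT : finGroupType) (p : nat) (G : {group gT}).
Hypotheses (pG : p.-group G) (esG : extraspecial G).
Implicit Types x y z g h : gT.

Let p_pr : prime p := extraspecial_prime pG esG.
Let oZ : #|'Z(G)| = p := card_center_extraspecial pG esG.
Let sZG : 'Z(G) \subset G := center_sub G.

Lemma extraspecial_noncomm x :
  x \in G -> x \notin 'Z(G) -> exists2 y, y \in G & [~ x, y] != 1.
Proof.
move=> Gx notZx; apply/exists_inP; apply: contraR notZx => /exists_inPn cGx.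
apply/centerP; split=> // y Gy; apply/commgP; exact: negbNE (cGx y Gy).
Qed.

(** Conjugation by powers of some y not commuting with x multiplies x by the powers of [[~ x, y]],
    which exhaust the centre. *)
Lemma extraspecial_coset_trans x z : x \in G -> x \notin 'Z(G) -> z \in 'Z(G) ->
  exists2 a, a \in Aut G & a x = x * z.
Proof.
move=> Gx notZx Zz; have [y Gy ntxy] := extraspecial_noncomm Gx notZx.
have /cycleP[i ->] : z \in <[[~ x, y]]>.
  by rewrite (extraspecial_cycleZ pG esG) ?(extraspecial_comm_center esG).
exists (conj_aut G (y ^+ i)); first exact: Aut_aut.
by rewrite conj_autE ?groupX // conjg_mulR (extraspecial_commgX esG).
Qed.

Lemma extraspecial_center_trans z t :
    z \in 'Z(G) -> z != 1 -> t \in 'Z(G) -> t != 1 ->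
  exists2 a, a \in Aut G & a z = t.
Proof.
move=> Zz ntz Zt ntt; case: (even_prime p_pr) => [p2|p_odd]; last first.
  exact: (extraspecial_dilation pG esG).
(* For p = 2 the centre has only one nontrivial element. *)
exists 1; rewrite ?group1 // perm1.
have : t \in <[z]> by rewrite (extraspecial_cycleZ pG esG).
rewrite cycle2g ?(extraspecial_orderZ pG esG) // !inE (negPf ntt) /=.
by move/eqP.
Qed.

(** If all one-letter specializations of w are central, then w vanishes on the abelian group G /
    Z(G). Otherwise some specialization is g |-> g^n with n prime to p, which is onto. *)
Lemma extraspecial_word_image d (w : word d) :
  word_image G w = G \/ word_image G w \subset 'Z(G).
Proof.
have sing i := eval_word_single G w i.
case: (boolP [forall i, forall g in G,
    eval_word w (fun j => if j == i then g else 1) \in 'Z(G)]) => [/forallP Zw|].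
  right; apply/subsetP=> _ /word_imageP[x Gx ->].
  have nZ := normal_norm (center_normal G).
  have Gwx := eval_word_in w Gx.
  have NG u : u \in G -> u \in 'N('Z(G)) by apply: subsetP.
  apply: coset_idr; first exact: NG.
  have cosE (v : 'I_d -> gT) : (forall i, v i \in G) ->
      coset 'Z(G) (eval_word w v) = eval_word w (coset 'Z(G) \o v).
    move=> Gy; apply: (@eval_word_morph _ 'N('Z(G))%G) => i; exact: NG.
  rewrite cosE //; apply: (@eval_word_abelian1 _ (G / 'Z(G))%G).
  - by case: esG => [[_ defG'] _]; apply: sub_der1_abelian; rewrite defG'.
  - by move=> i; apply: mem_quotient.
  move=> i; rewrite -[RHS](coset_id (forall_inP (Zw i) _ (Gx i))).
  rewrite cosE; last by move=> j; case: ifP.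
  by apply: eq_eval_word => j /=; case: ifP => // _; rewrite morph1.
case/forallPn=> i /forall_inPn[g Gg notZ]; left.
have [n sE] := sing i; rewrite sE // in notZ.
(* If p divided n, then g^n would be a power of the central element g^p. *)
have con : coprime #|G| n.
  rewrite (card_pgroup pG) coprimeXl // prime_coprime //.
  apply: contra notZ => /dvdnP[m ->]; rewrite mulnC expgM groupX //.
  exact: (extraspecial_expgp pG esG).
apply/eqP; rewrite eqEsubset word_image_sub; apply/subsetP=> u Gu.
apply/word_imageP; exists (fun j => if j == i then u ^+ expg_invn G n else 1).
  by move=> j; case: ifP => // _; rewrite groupX.
by rewrite sE ?groupX // -expgM mulnC expgM expgK.
Qed.

Lemma extraspecial_is_word_image A :
  is_word_image G A <-> A \in [set [set 1]; 'Z(G) : {set gT}; G : {set gT}].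
Proof.
split=> [[d [w [_ <-]]]|].
  rewrite !inE; case: (extraspecial_word_image w) => [->|sZ]; first by rewrite eqxx orbT.
  case: (boolP (word_image G w \subset [set 1])) => [s1|].
    by rewrite eqEsubset s1 sub1set word_image1.
  case/subsetPn=> z wz; rewrite inE => ntz.
  suffices -> : word_image G w = 'Z(G) by rewrite eqxx orbT.
  apply/eqP; rewrite eqEsubset sZ; apply/subsetP=> t Zt.
  have [->|ntt] := eqVneq t 1; first exact: word_image1.
  have [a AutGa <-] := extraspecial_center_trans (subsetP sZ z wz) ntz Zt ntt.
  exact: word_image_Aut.
rewrite !inE => /orP[/orP[]|] /eqP->.
- exists 1%N, [::]; split=> //; apply/setP=> u; rewrite inE.
  by apply/word_imageP/eqP=> [[x _ ->]|->] //; exists (fun=> 1).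
(* The commutator word. A single noncommuting pair x, y yields the whole centre through the pairs x,
   y^i. *)
- exists 2, [:: (ord0, true); (ord_max, true); (ord0, false); (ord_max, false)].
  split=> //; apply/setP=> u.
  have wE (x : 'I_2 -> gT) : eval_word [:: (ord0, true); (ord_max, true); (ord0, false);
      (ord_max, false)] x = [~ x ord0, x ord_max] :> gT.
    by rewrite /= mulg1.
  apply/word_imageP/idP=> [[x Gx ->]|Zu].
    by rewrite wE (extraspecial_comm_center esG).
  have [x Gx notZx] : exists2 x, x \in G & x \notin 'Z(G).
    apply/subsetPn; apply: contra (extraspecial_nonabelian esG) => sGZ.
    exact: abelianS sGZ (center_abelian G).
  have [y Gy ntxy] := extraspecial_noncomm Gx notZx.
  have /cycleP[i uE] : u \in <[[~ x, y]]>.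
    by rewrite (extraspecial_cycleZ pG esG) ?(extraspecial_comm_center esG).
  exists (fun j : 'I_2 => if j == ord0 then x else y ^+ i).
    by move=> j; case: ifP => // _; apply: groupX.
  by rewrite wE /= (extraspecial_commgX esG).
- exists 1%N, [:: (ord0, false)]; split=> //; apply/setP=> u.
  apply/word_imageP/idP=> [[x Gx ->]|Gu]; first by rewrite /= mulg1.
  by exists (fun=> u); rewrite //= mulg1.
Qed.

Lemma num_impostors_extraspecial :
  num_impostors_is G (2 ^ #|Aut_orbits G| - 3).
Proof.
set T := [set [set 1]; 'Z(G) : {set gT}; G : {set gT}].
have ntZ : 'Z(G) != 1 by rewrite -cardG_gt1 oZ prime_gt1.
have neqZG : 'Z(G) != G.
  apply: contra (extraspecial_nonabelian esG) => /eqP <-; exact: center_abelian.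
have ntG : G :!=: 1.
  by apply: contra ntZ => /eqP G1; rewrite -subG1 -G1 center_sub.
exists (candidates G :\: T); split=> [|A]; last first.
  split=> [/setDP[/candidatesP cA notTA]|[/candidatesP cA notwA]].
    by split=> // /extraspecial_is_word_image; apply/negP.
  by apply/setDP; split=> //; apply/negP=> /extraspecial_is_word_image.
(* The three word images are candidates, and they are pairwise distinct since 1 < Z(G) < G. *)
rewrite cardsD card_candidates (setIidPr _); last first.
  apply/subsetP=> A TA; apply/candidatesP.
  have [d [w [_ <-]]] := (extraspecial_is_word_image A).2 TA.
  split; first exact: word_image_sub.
  split; first exact: word_image1.
  by move=> a AutGa; apply/subsetP=> _ /imsetP[u wu ->]; apply: word_image_Aut.
by rewrite /T setUC cardsU1 cards2 !inE negb_or ntG eq_sym neqZG eq_sym ntZ.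
Qed.

End AutExtraspecial.

(** * Orbits for p = 2 *)

Section TwoGroup.

Variables (gT : finGroupType) (G : {group gT}).
Hypotheses (pG : 2.-group G) (esG : extraspecial G).
Implicit Types x y z g h : gT.

Let sZG : 'Z(G) \subset G := center_sub G.

Lemma extraspecial2_center_eq z t :
  z \in 'Z(G) -> z != 1 -> t \in 'Z(G) -> t != 1 -> z = t.
Proof.
move=> Zz ntz Zt ntt; have : t \in <[z]> by rewrite (extraspecial_cycleZ pG esG).
rewrite cycle2g ?(extraspecial_orderZ pG esG) // !inE (negPf ntt) /=.
by move/eqP.
Qed.

(** Squaring is a quadratic form whose polar form is the commutator; [[~ y, x]] and [[~ x, y]] are
    both the unique central involution. *)
Lemma extraspecial2_sqr_comm x y : x \in G -> y \in G -> [~ x, y] != 1 ->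
  (x * y) ^+ 2 = x ^+ 2 * y ^+ 2 * [~ x, y].
Proof.
move=> Gx Gy ntxy; have Zyx := extraspecial_comm_center esG Gy Gx.
rewrite expMg_Rmul ?bin2; try exact: (centerC _ Zyx).
congr (_ * _); apply: extraspecial2_center_eq => //.
  by rewrite -invg_comm eq_invg1.
exact: (extraspecial_comm_center esG).
Qed.

(** When x and y commute, y = x s with s^2 = 1. A central s is handled by an inner automorphism.
    Otherwise take v commuting with s but not with x: if v^2 = 1, a Siegel map applies; if not, two
    transvections pass through x v. *)
Lemma extraspecial2_transitive x y :
    x \in G -> x \notin 'Z(G) -> y \in G -> y \notin 'Z(G) ->
    x ^+ 2 = y ^+ 2 ->
  exists2 a, a \in Aut G & a x = y.
Proof.
move=> Gx notZx Gy notZy xy2.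
have [cxy|ntxy] := eqVneq [~ x, y] 1; last first.
  exact: (extraspecial_transvection pG esG).
have {}cxy : commute x y by apply/commgP/eqP.
pose s := x^-1 * y; have Gs : s \in G by rewrite groupM ?groupV.
have defy : y = x * s by rewrite mulKVg.
have csx : commute s x by rewrite /commute -defy /s -mulgA -cxy mulKg.
clearbody s.
have s2 : s ^+ 2 = 1.
  apply: (mulgI (x ^+ 2)); rewrite -expgMn; last exact: commute_sym.
  by rewrite -defy mulg1.
have [Zs|notZs] := boolP (s \in 'Z(G)).
  by rewrite defy; apply: (extraspecial_coset_trans pG esG).
(* Without such a v, everything commuting with s commutes with x. Over F_2 the forms (s, -) and (x,
   -) then coincide, so s^-1 x is central; as s^2 = 1 it equals y, a contradiction. *)
have [v Gv /andP[csv ncvx]] : exists2 v, v \in G & ([~ s, v] == 1) && ([~ v, x] != 1).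
  apply/exists_inP; apply: contraR notZy => /exists_inPn noV.
  have cs h : h \in G -> [~ s, h] = 1 -> [~ x, h] = 1.
    move=> Gh sh; move: (noV h Gh); rewrite sh eqxx negbK => /eqP.
    by rewrite -(invg_comm h x) => ->; rewrite invg1.
  have [h0 Gh0 nth0] := extraspecial_noncomm Gx notZx.
  have cZ u h : u \in G -> h \in G -> [~ u, h] \in 'Z(G).
    exact: (extraspecial_comm_center esG).
  have sx h : h \in G -> [~ s, h] = [~ x, h].
    move=> Gh; have [c1|nt1] := eqVneq [~ s, h] 1; first by rewrite c1 cs.
    have nts0 : [~ s, h0] != 1 by apply: contra nth0 => /eqP/(cs _ Gh0)->.
    have e1 : [~ s, h] = [~ s, h0] by apply: extraspecial2_center_eq; rewrite ?cZ.
    have sZ1 : [~ s, h0] ^+ 2 = 1 by rewrite (extraspecial_expZ pG esG) ?cZ.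
    have e2 : [~ s, h * h0] = 1.
      by rewrite (extraspecial_commgM esG) // e1.
    have e3 : [~ x, h0] = [~ s, h0] by apply: extraspecial2_center_eq; rewrite ?cZ.
    have := cs _ (groupM Gh Gh0) e2; rewrite (extraspecial_commgM esG) // e3 e1.
    by rewrite -sZ1 expgS expg1 => /mulIg->.
  have Zt : s^-1 * x \in 'Z(G).
    apply/centerP; split=> [|h Gh]; first by rewrite groupM ?groupV.
    apply/commgP/eqP; rewrite (extraspecial_commMg esG) ?groupV // -sx //.
    by rewrite -(extraspecial_commMg esG) ?groupV // mulVg comm1g.
  have -> : y = (s^-1 * x) * s ^+ 2.
    by rewrite defy expgS expg1 mulgA -(mulgA s^-1) -csx mulKg.
  by rewrite s2 mulg1.
have ncvy : [~ v, y] != 1.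
  rewrite defy (extraspecial_commgM esG) // -(invg_comm s v) (eqP csv).
  by rewrite invg1 mulg1.
have [v2|ntv2] := eqVneq (v ^+ 2) 1.
  rewrite defy; apply: (extraspecial_siegel pG esG) ncvx => //.
  exact/commgP.
pose w := x * v; have Gw : w \in G by rewrite groupM.
have ncxv : [~ x, v] != 1 by rewrite -invg_comm eq_invg1.
(* Both v^2 and [[~ x, v]] are the central involution, so they cancel in (x v)^2. *)
have xw2 : x ^+ 2 = w ^+ 2.
  rewrite extraspecial2_sqr_comm // -[LHS]mulg1 -(mulgA (x ^+ 2)); congr (_ * _).
  have <- : v ^+ 2 = [~ x, v].
    apply: extraspecial2_center_eq => //; first exact: (extraspecial_expgp pG esG).
    exact: (extraspecial_comm_center esG).
  have := extraspecial_expZ pG esG (extraspecial_expgp pG esG Gv).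
  by rewrite expgS expg1.
have [|a AutGa ax] := extraspecial_transvection pG esG Gx Gw _ xw2.
  by rewrite (extraspecial_commgM esG) // commgg mul1g.
have [|b AutGb bw] := extraspecial_transvection pG esG Gw Gy _ (esym (etrans (esym xy2) xw2)).
  by rewrite (extraspecial_commMg esG) // (eqP (introT commgP cxy)) mul1g.
by exists (a * b); rewrite ?groupM // permM ax.
Qed.

End TwoGroup.

Section TwoOrbits.

Variables (gT : finGroupType) (G : {group gT}).
Hypotheses (pG : 2.-group G) (esG : extraspecial G).

Let sZG : 'Z(G) \subset G := center_sub G.
Let noncentral (b : bool) := [set x in G :\: 'Z(G) | (x ^+ 2 == 1) == b].

(** [noncentral true] consists of the noncentral involutions, [noncentral false] of the elements of
    order 4. *)
Let ncP b x :
  reflect [/\ x \in G, x \notin 'Z(G) & (x ^+ 2 == 1) = b] (x \in noncentral b).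
Proof.
by rewrite !inE; apply: (iffP andP) => [[/andP[-> ->] /eqP]|[-> -> ->]].
Qed.

Lemma extraspecial2_Aut_orbits :
  Aut_orbits G = [set 'Z(G)^#; noncentral true; noncentral false] :\ set0.
Proof.
have Qcases B : B \in [set 'Z(G)^#; noncentral true; noncentral false] ->
    B = 'Z(G)^# \/ exists b, B = noncentral b.
  by rewrite !inE => /orP[/orP[]|] /eqP->; [left | right; exists true | right; exists false].
apply: Aut_orbits_eq => [g /setD1P[ntg Gg]|B|B a|B].
- have [Zg|notZg] := boolP (g \in 'Z(G)).
    by exists 'Z(G)^#; [rewrite !inE eqxx | rewrite in_setD1 ntg].
  exists (noncentral (g ^+ 2 == 1)); last exact/ncP.
  by case: (g ^+ 2 == 1); rewrite !inE eqxx ?orbT.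
- case/Qcases=> [-> x /setD1P[ntx Zx]|[b ->] x /ncP[Gx notZx _]].
    by rewrite in_setD1 ntx (subsetP sZG).
  by rewrite in_setD1 Gx andbT; apply: contraNneq notZx => ->; apply: group1.
- case/Qcases=> [->|[b ->]] AutGa x.
    case/setD1P=> ntx Zx; rewrite in_setD1 (Aut_mem_char (center_char G)) ?(subsetP sZG) //.
    rewrite Zx andbT; apply: contra ntx => /eqP ax1; apply/eqP/(@perm_inj _ a).
    by rewrite ax1 -(autmE AutGa) morph1.
  case/ncP=> Gx notZx x2; apply/ncP; rewrite Aut_closed //.
  rewrite (Aut_mem_char (center_char G)) //; split=> //; rewrite -x2.
  by rewrite -(autmE AutGa) -morphX // morph_injm_eq1 ?injm_autm ?groupX.
- case/Qcases=> [->|[b ->]] x y.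
    by move=> /setD1P[ntx Zx] /setD1P[nty Zy]; apply: (extraspecial_center_trans pG esG).
  move=> /ncP[Gx notZx x2] /ncP[Gy notZy y2].
  apply: extraspecial2_transitive => //; case: b x2 y2 => [/eqP-> /eqP->//|x2 y2].
  by apply: (extraspecial2_center_eq pG esG); rewrite ?x2 ?y2 ?(extraspecial_expgp pG esG).
Qed.

Lemma extraspecial2_noncentral_order4 : exists x, x \in noncentral false.
Proof.
have exp4 := exponent_2extraspecial pG esG.
have /exists_inP[x Gx x2] : [exists x in G, x ^+ 2 != 1].
  rewrite -negb_forall_in; apply/negP=> /forall_inP all1.
  have : exponent G %| 2 by apply/exponentP=> x /all1/eqP.
  by rewrite exp4.
exists x; apply/ncP; split=> //; last exact: negPf.
by apply: contra x2 => Zx; rewrite (extraspecial_expZ pG esG).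
Qed.

(** Without noncentral involutions ['Ohm_1(G)] has order 2, so G is cyclic or generalized
    quaternion. Being nonabelian rules out the former, and a derived subgroup of order 2 leaves only
    order 8. *)
Lemma isog_Q8_noncentral_involution :
  (G \isog 'Q_8) = (noncentral true == set0).
Proof.
have order4 m : G \isog 'Q_(2 ^ m) -> 2 < m -> (m == 3) && (noncentral true == set0).
  move=> isoG m_gt2; have [[x y] genG _] := generators_quaternion m_gt2 isoG.
  have [_ [_ _ oG' _] [defZ _ inv _ _] _ _] := quaternion_structure m_gt2 genG isoG.
  have oZ : #|'Z(G)| = 2 by apply: (card_center_extraspecial pG).
  have [[_ defG'] _] := esG.
  apply/andP; split.
    have : (2 ^ m.-2 == 2 ^ 1)%N by rewrite -oG' defG' oZ.
    by rewrite eqn_exp2l //; lia.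
  apply/set0Pn=> -[u /ncP[Gu notZu u2]].
  have notZu0 := notZu; case/negP: notZu; rewrite defZ (inv u Gu) ?cycle_id //.
  apply: nt_prime_order => //; first exact/eqP.
  by apply: contra notZu0 => /eqP->; apply: group1.
apply/idP/idP=> [isoG|/eqP I0].
  by have /andP[] := order4 3 isoG isT.
have sO : 'Ohm_1(G) \subset 'Z(G).
  rewrite (OhmE 1 pG) gen_subG; apply/subsetP=> u; rewrite 2!inE => /andP[Gu u2].
  apply: contraT => notZu; have : u \in noncentral true by apply/ncP.
  by rewrite I0 inE.
have oZ : #|'Z(G)| = 2 by apply: (card_center_extraspecial pG).
have ntG : G :!=: 1.
  by apply: contra (extraspecial_nonabelian esG) => /eqP->; apply: abelian1.
have oO : #|'Ohm_1(G)| = 2.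
  apply/eqP; rewrite eqn_leq -{1}oZ subset_leq_card //= cardG_gt1.
  by rewrite Ohm1_eq1.
case/(prime_Ohm1P pG ntG)/orP: oO => [cG|/andP[_ /eqP/quaternion_classP[m m_gt2 isoG]]].
  by case/negP: (extraspecial_nonabelian esG); apply: cyclic_abelian.
by have /andP[/eqP m3 _] := order4 m isoG m_gt2; rewrite m3 in isoG.
Qed.

Lemma card_extraspecial2_orbits :
  #|Aut_orbits G| = if G \isog 'Q_8 then 2 else 3.
Proof.
have [x Jx] := extraspecial2_noncentral_order4.
have /trivgPn[z Zz ntz] : 'Z(G) != 1.
  by rewrite -cardG_gt1 (card_center_extraspecial pG esG).
have Z1z : z \in 'Z(G)^# by rewrite in_setD1 ntz.
have neqZ b : 'Z(G)^# != noncentral b.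
  by apply/eqP=> /setP/(_ z); rewrite Z1z => /esym/ncP[_ /negP].
have neq_tf : noncentral true != noncentral false.
  apply/eqP=> /setP/(_ x); rewrite Jx => /ncP[_ _ x2].
  by case/ncP: Jx => _ _; rewrite x2.
have J0 : noncentral false != set0 by apply/set0Pn; exists x.
have Z0 : 'Z(G)^# != set0 by apply/set0Pn; exists z.
have := cardsD1 set0 [set 'Z(G)^#; noncentral true; noncentral false].
rewrite -extraspecial2_Aut_orbits isog_Q8_noncentral_involution.
rewrite -setUA cardsU1 cards2 !inE negb_or !neqZ neq_tf.
rewrite !(eq_sym set0) (negPf J0) (negPf Z0) orbF /=.
by case: (_ == set0) => /= -[].
Qed.

End TwoOrbits.

(** * Orbits for p odd *)

(** No group is the union of two proper subgroups. *)
Lemma group_avoid2 (gT : finGroupType) (L H K : {group gT}) :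
    ~~ (L \subset H) -> ~~ (L \subset K) ->
  exists2 l, l \in L & (l \notin H) && (l \notin K).
Proof.
move=> /subsetPn[h Lh notHh] /subsetPn[k Lk notKk].
have [Kh|notKh] := boolP (h \in K); last by exists h; rewrite ?notHh.
have [Hk|notHk] := boolP (k \in H); last by exists k; rewrite ?notHk.
exists (h * k); first exact: groupM.
by rewrite groupMr // groupMl // notHh.
Qed.

Section OddOrbits.

Variables (gT : finGroupType) (p : nat) (G : {group gT}).
Hypotheses (pG : p.-group G) (esG : extraspecial G) (p_odd : odd p).
Implicit Types x y z g h : gT.

Let p_pr : prime p := extraspecial_prime pG esG.
Let oZ : #|'Z(G)| = p := card_center_extraspecial pG esG.
Let sZG : 'Z(G) \subset G := center_sub G.
Let Omega := 'Ohm_1(G).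
Let U := 'C_G(Omega).
Let sOG : Omega \subset G := Ohm_sub 1 G.

(** For odd p the prime divides ['C(p, 2)], so the commutator term of the collection formula
    disappears. *)
Lemma extraspecial_odd_expM x y :
  x \in G -> y \in G -> (x * y) ^+ p = x ^+ p * y ^+ p.
Proof.
move=> Gx Gy; have Zyx := extraspecial_comm_center esG Gy Gx.
rewrite expMg_Rmul; try exact: (centerC _ Zyx).
have /dvdnP[k ->] : p %| 'C(p, 2).
  by rewrite prime_dvd_bin //= odd_prime_gt2.
by rewrite mulnC expgM (extraspecial_expZ pG esG Zyx) expg1n mulg1.
Qed.

Lemma extraspecial_odd_Ohm1 x : x \in G -> (x \in 'Ohm_1(G)) = (x ^+ p == 1).
Proof.
move=> Gx; have [|expO _ _] := Ohm1_extraspecial_odd pG esG.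
  by have [n ->] := p_natP pG; rewrite oddX p_odd orbT.
apply/idP/eqP=> [Ox|xp]; first by rewrite -expO expg_exponent.
by rewrite (OhmE 1 pG) mem_gen // !inE Gx expn1 xp eqxx.
Qed.

Let OmE := extraspecial_odd_Ohm1.

Let sZO : 'Z(G) \subset Omega.
Proof.
apply/subsetP=> z Zz; rewrite OmE ?(subsetP sZG) //.
by rewrite (extraspecial_expZ pG esG).
Qed.

Let sZU : 'Z(G) \subset U.
Proof. by rewrite setIS // centS. Qed.

Lemma extraspecial_Ohm1_index : Omega != G -> #|G : Omega| = p.
Proof.
have [|_ iO _] := Ohm1_extraspecial_odd pG esG.
  by have [n ->] := p_natP pG; rewrite oddX p_odd orbT.
move=> ntO; have /primeP[_ /(_ _ iO)] := p_pr.
rewrite indexg_eq1 => /orP[sGO|/eqP//].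
by case/negP: ntO; rewrite eqEsubset sOG.
Qed.

Lemma extraspecial_Ohm1_mul h : h \in G -> h \notin Omega -> Omega * <[h]> = G.
Proof.
move=> Gh notOh; have iO : #|G : Omega| = p.
  by apply: extraspecial_Ohm1_index; apply: contraNneq notOh => ->.
have maxO : maximal 'Ohm_1(G) G by apply: p_index_maximal; rewrite ?iO.
by rewrite (mulg_normal_maximal (Ohm_normal 1 G) maxO) ?cycle_subG.
Qed.

(** An element u of U outside [Omega] would centralize [Omega] and itself, which generate G; it
    would be central, hence in [Omega]. *)
Lemma extraspecial_centOhm1_sub : U \subset Omega.
Proof.
apply/subsetP=> u /setIP[Gu cOu]; apply: contraT => notOu.
case/negP: (notOu); apply: subsetP sZO _ _; rewrite inE Gu.
by rewrite -(extraspecial_Ohm1_mul Gu notOu) centM inE cOu cent_cycle cent1id.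
Qed.

(* Commutation with [g] and the [p]-th power map are homomorphisms from
   [G / Omega], which has order [p], to the centre, hence proportional. *)
Lemma extraspecial_comm_power g : g \in U ->
  exists m, {in G, forall h, [~ g, h] = (h ^+ p) ^+ m}.
Proof.
move=> /setIP[Gg cOg].
have [eqO|neqO] := eqVneq Omega G.
  exists 0%N => h Gh; apply/eqP/commgP; apply: (centP cOg); by rewrite eqO.
have /subsetPn[h0 Gh0 notOh0] : ~~ (G \subset Omega).
  by apply: contra neqO => sGO; rewrite eqEsubset sOG.
have nth0 : h0 ^+ p != 1 by rewrite -OmE.
have /cycleP[m mE] : [~ g, h0] \in <[h0 ^+ p]>.
  by rewrite (extraspecial_cycleZ pG esG) ?(extraspecial_expgp pG esG) // (extraspecial_comm_center esG).
exists m => h; rewrite -{1}(extraspecial_Ohm1_mul Gh0 notOh0).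
(* Writing h = o h0^i, both sides ignore o and reduce to i-th powers of their values at h0. *)
case/mulsgP=> o _ Oo /cycleP[i ->] ->; have Go := subsetP sOG o Oo.
rewrite (extraspecial_commgM esG) ?groupX // (extraspecial_commgX esG) //.
rewrite extraspecial_odd_expM ?groupX //.
have /eqP-> : [~ g, o] == 1 by apply/commgP/(centP cOg).
have /eqP-> : o ^+ p == 1 by rewrite -OmE.
by rewrite !mul1g mE -!expgM; congr (_ ^+ _); lia.
Qed.

(** Applying a to [g, h'] = h'^(pm) and putting h = a h' gives [a g, h] = h^(pm) = [g, h], so a g
    and g agree modulo the centre. *)
Lemma Aut_centOhm1 a g : a \in Aut G -> g \in U -> a g * g^-1 \in 'Z(G).
Proof.
move=> AutGa Ug; have [m mE] := extraspecial_comm_power Ug.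
have Gg : g \in G by case/setIP: Ug.
have Gag := Aut_closed AutGa Gg.
apply/centerP; split=> [|h Gh]; first by rewrite groupM ?groupV.
pose h' := a^-1 h; have Gh' : h' \in G by rewrite Aut_closed ?groupV.
have defh : h = a h' by rewrite permKV.
apply/commgP/eqP; rewrite (extraspecial_commMg esG) ?groupV //.
have -> : [~ a g, h] = [~ g, h].
  rewrite mE // defh -(autmE AutGa) -morphR // mE //.
  by rewrite !morphX ?groupX.
by rewrite -(extraspecial_commMg esG) ?groupV // mulgV comm1g.
Qed.

(** Commuting x and y are linked through x o, with o in [Omega] commuting with neither. Multiplying
    by o keeps the p-th power, so two transvections apply. *)
Lemma extraspecial_odd_transitive x y :
    x \in G -> x \notin U -> y \in G -> y \notin U -> x ^+ p = y ^+ p ->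
  exists2 a, a \in Aut G & a x = y.
Proof.
move=> Gx notUx Gy notUy xyp.
have [cxy|ntxy] := eqVneq [~ x, y] 1; last first.
  exact: (extraspecial_transvection pG esG).
have notC u : u \in G -> u \notin U -> ~~ (Omega \subset 'C[u]).
  by move=> Gu; apply: contra => sOC; rewrite inE Gu -sub_cent1.
have [o Oo /andP[ncx ncy]] := group_avoid2 (notC x Gx notUx) (notC y Gy notUy).
have Go := subsetP sOG o Oo; pose w := x * o; have Gw : w \in G by rewrite groupM.
have xwp : x ^+ p = w ^+ p.
  by rewrite extraspecial_odd_expM //; move: Oo; rewrite OmE // => /eqP->; rewrite mulg1.
have ncC u : o \notin 'C[u] -> [~ u, o] != 1.
  by apply: contra => /commgP cuo; apply/cent1P.
have [|a AutGa ax] := extraspecial_transvection pG esG Gx Gw _ xwp.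
  by rewrite (extraspecial_commgM esG) // commgg mul1g ncC.
have [|b AutGb bw] := extraspecial_transvection pG esG Gw Gy _ (etrans (esym xwp) xyp).
  rewrite (extraspecial_commMg esG) // cxy mul1g -invg_comm eq_invg1.
  exact: ncC.
by exists (a * b); rewrite ?groupM // permM ax.
Qed.

(** The coset Z(G) is removed because it contains 1; its nontrivial part is listed separately in
    [Q]. *)
Let cosetsU := rcosets 'Z(G) U :\ ('Z(G) : {set gT}).
Let Q := [set 'Z(G)^#; Omega :\: U; G :\: Omega] :|: cosetsU.

Lemma extraspecial_odd_Aut_orbits : Aut_orbits G = Q :\ set0.
Proof.
have chU : [group of U] \char G by rewrite subcent_char ?char_refl ?Ohm_char.
have Qcases (B : {set gT}) : B \in Q -> [\/ B = 'Z(G)^#, B = Omega :\: U, B = G :\: Omega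
    | exists g, [/\ g \in U, g \notin 'Z(G) & B = 'Z(G) :* g]].
  case/setUP=> [|/setD1P[ntB /rcosetsP[g Ug defB]]].
    by rewrite !inE => /orP[/orP[]|] /eqP; [constructor 1 | constructor 2 | constructor 3].
  constructor 4; exists g; split=> //.
  by apply: contra ntB => Zg; rewrite defB rcoset_id.
apply: Aut_orbits_eq => [g /setD1P[ntg Gg]|B|B a|B].
- have [Og|notOg] := boolP (g \in Omega); last first.
    by exists (G :\: Omega); [rewrite !inE eqxx !orbT | rewrite inE notOg].
  have [Ug|notUg] := boolP (g \in U); last first.
    by exists (Omega :\: U); [rewrite !inE eqxx !orbT | rewrite inE notUg].
  have [Zg|notZg] := boolP (g \in 'Z(G)).
    by exists 'Z(G)^#; [rewrite !inE eqxx | rewrite in_setD1 ntg].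
  exists ('Z(G) :* g); last exact: rcoset_refl.
  rewrite in_setU in_setD1; apply/orP; right; apply/andP; split.
    by apply: contra notZg => /eqP <-; apply: rcoset_refl.
  by apply/rcosetsP; exists g.
- have nt1 (x : gT) (H : {group gT}) : x \notin H -> x \in G -> x \in G^#.
    by move=> notHx Gx; rewrite in_setD1 Gx andbT; apply: contraNneq notHx => ->; apply: group1.
  case/Qcases=> [->|->|->|[g [Ug notZg ->]]] x.
  + by case/setD1P=> ntx Zx; rewrite in_setD1 ntx (subsetP sZG).
  + by case/setDP=> Ox /nt1; apply; apply: subsetP Ox.
  + by case/setDP=> Gx /nt1; apply.
  case/rcosetP=> z Zz ->; have Gz := subsetP sZG z Zz.
  apply: (nt1 _ 'Z(G)%G); first by rewrite groupMl.
  by rewrite groupM //; case/setIP: Ug.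
- move=> QB AutGa; have memU x := Aut_mem_char chU AutGa (x := x).
  have memO x := Aut_mem_char (Ohm_char 1 G) AutGa (x := x).
  case/Qcases: QB => [->|->|->|[g [Ug notZg ->]]] x.
  + case/setD1P=> ntx Zx; rewrite in_setD1 (Aut_mem_char (center_char G)) ?(subsetP sZG) //.
    rewrite Zx andbT; apply: contra ntx => /eqP ax1; apply/eqP/(@perm_inj _ a).
    by rewrite ax1 -(autmE AutGa) morph1.
  + case/setDP=> Ox notUx; have Gx := subsetP sOG x Ox.
    by apply/setDP; rewrite memO // memU.
  + by case/setDP=> Gx notOx; apply/setDP; rewrite memO // Aut_closed.
  case/rcosetP=> z Zz ->; have Gz := subsetP sZG z Zz.
  have Gg : g \in G by case/setIP: Ug.
  have -> : a (z * g) = a z * (a g * g^-1) * g.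
    by rewrite -mulgA mulgKV -!(autmE AutGa) morphM.
  rewrite mem_rcoset mulgK groupM ?Aut_centOhm1 //.
  by rewrite (Aut_mem_char (center_char G)).
case/Qcases=> [->|->|->|[g [Ug notZg ->]]] x y.
- by move=> /setD1P[ntx Zx] /setD1P[nty Zy]; apply: (extraspecial_center_trans pG esG).
- move=> /setDP[Ox notUx] /setDP[Oy notUy].
  have [Gx Gy] := (subsetP sOG x Ox, subsetP sOG y Oy).
  apply: extraspecial_odd_transitive => //.
  by move: Ox Oy; rewrite !OmE // => /eqP-> /eqP->.
- move=> /setDP[Gx notOx] /setDP[Gy notOy].
  have notU u : u \notin Omega -> u \notin U.
    by apply: contra; apply: (subsetP extraspecial_centOhm1_sub).
  have nt u : u \in G -> u \notin Omega -> u ^+ p != 1 by move=> Gu; rewrite OmE.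
  (* Outside [Omega] the p-th powers may differ: first move x^p to y^p inside the centre, then use
     transitivity for equal p-th powers. *)
  have [a AutGa axp] := extraspecial_center_trans pG esG
    (extraspecial_expgp pG esG Gx) (nt x Gx notOx)
    (extraspecial_expgp pG esG Gy) (nt y Gy notOy).
  have [|||b AutGb bax] := @extraspecial_odd_transitive (a x) y _ _ Gy (notU y notOy).
  + exact: Aut_closed.
  + by rewrite (Aut_mem_char chU) ?notU.
  + by rewrite -axp -!(autmE AutGa) morphX.
  by exists (a * b); rewrite ?groupM // permM.
have Gg : g \in G by case/setIP: Ug.
move=> /rcosetP[z Zz ->] /rcosetP[t Zt ->]; have Gz := subsetP sZG z Zz.
have -> : t * g = z * g * (z^-1 * t).
  by rewrite -(centerC Gg Zt) -(centerC Gg Zz) -!mulgA mulKVg.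
apply: (extraspecial_coset_trans pG esG).
- exact: groupM.
- by rewrite groupMl.
by rewrite groupM ?groupV.
Qed.

(** Here [Omega] = G and U = Z(G), so only the nontrivial central and the noncentral elements
    remain. *)
Lemma card_extraspecial_odd_orbits_exp : exponent G = p -> #|Aut_orbits G| = 2.
Proof.
move=> expG; have OG : Omega = G.
  apply/eqP; rewrite eqEsubset sOG; apply/subsetP=> x Gx.
  by rewrite OmE // -expG expg_exponent.
have UZ : U = 'Z(G) by rewrite /U OG.
have C0 : cosetsU = set0.
  apply/setP=> B; rewrite in_setD1 inE; apply/andP=> -[ntB /rcosetsP[g]].
  by rewrite UZ => Zg defB; rewrite defB rcoset_id ?eqxx in ntB.
have /trivgPn[z Zz ntz] : 'Z(G) != 1 by rewrite -cardG_gt1 oZ prime_gt1.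
have Z1z : z \in 'Z(G)^# by rewrite in_setD1 ntz.
have [x Gx notZx] : exists2 x, x \in G & x \notin 'Z(G).
  apply/subsetPn; apply: contra (extraspecial_nonabelian esG) => sGZ.
  exact: abelianS sGZ (center_abelian G).
have neq : 'Z(G)^# != G :\: 'Z(G).
  by apply/eqP=> /setP/(_ z); rewrite Z1z in_setD Zz.
have Z0 : set0 != 'Z(G)^# by rewrite eq_sym; apply/set0Pn; exists z.
have J0 : set0 != G :\: 'Z(G).
  by rewrite eq_sym; apply/set0Pn; exists x; rewrite in_setD notZx.
rewrite extraspecial_odd_Aut_orbits /Q C0 setU0 UZ OG setDv setUC setU1K.
  by rewrite cards2 neq.
by rewrite !inE negb_or Z0 J0.
Qed.

(** U has order p^2, giving p - 1 cosets besides Z(G), so [Q] has p + 2 members. Exactly one of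
    them, [Omega :\: U], can be empty, and it is when |[Omega]| = p^2, that is, |G| = p^3. *)
Lemma card_extraspecial_odd_orbits : exponent G = (p ^ 2)%N ->
  #|Aut_orbits G| = if #|G| == (p ^ 3)%N then p.+1 else p.+2.
Proof.
move=> expG; have p_gt1 := prime_gt1 p_pr; have p_gt0 := prime_gt0 p_pr.
have neqO : Omega != G.
  apply/eqP=> OG; have : exponent G %| p.
    by apply/exponentP=> x Gx; apply/eqP; rewrite -OmE // -/Omega OG.
  by rewrite expG -[X in _ %| X]expn1 dvdn_Pexp2l.
have iO := extraspecial_Ohm1_index neqO.
(* Nondegeneracy of the form: the centralizer of [Omega] has order |Z(G)| times the index of
   [Omega]. *)
have oU : #|U| = (p ^ 2)%N.
  by rewrite (card_subcent_extraspecial pG esG) // iO (setIidPl sZO) oZ.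
have oG : (#|Omega| * p)%N = #|G| by rewrite -iO Lagrange.
have ZnC : ('Z(G) : {set gT}) \in rcosets 'Z(G) U.
  by apply/rcosetsP; exists 1; rewrite ?group1 // mulg1.
have oC : #|cosetsU| = p.-1.
  have := cardsD1 ('Z(G) : {set gT}) (rcosets 'Z(G) U); rewrite ZnC.
  rewrite -/cosetsU -[#|rcosets _ _|]/(#|U : 'Z(G)|) => iU.
  have : #|U : 'Z(G)| = p.
    by apply/eqP; rewrite -(eqn_pmul2l p_gt0) -{1}oZ Lagrange // oU.
  by rewrite iU => <-.
have /trivgPn[z Zz ntz] : 'Z(G) != 1 by rewrite -cardG_gt1 oZ.
have Z1z : z \in 'Z(G)^# by rewrite in_setD1 ntz.
have [h Gh notOh] : exists2 h, h \in G & h \notin Omega.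
  by apply/subsetPn; apply: contra neqO => sGO; rewrite eqEsubset sOG.
have neqZO : 'Z(G)^# != Omega :\: U.
  by apply/eqP=> /setP/(_ z); rewrite Z1z in_setD (subsetP sZU).
have neqZG : 'Z(G)^# != G :\: Omega.
  by apply/eqP=> /setP/(_ z); rewrite Z1z in_setD (subsetP sZO).
have neqOG : Omega :\: U != G :\: Omega.
  by apply/eqP=> /setP/(_ h); rewrite !in_setD Gh notOh (negPf notOh) andbF.
have disj : [set 'Z(G)^#; Omega :\: U; G :\: Omega] :&: cosetsU = set0.
  apply/setP=> B; rewrite in_setI in_set0.
  apply/andP=> -[TB /setD1P[ntB /rcosetsP[g Ug defB]]].
  have Bg : g \in B by rewrite defB rcoset_refl.
  have notZg : g \notin 'Z(G) by apply: contra ntB => Zg; rewrite defB rcoset_id.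
  have Og := subsetP extraspecial_centOhm1_sub g Ug.
  move: TB Bg; rewrite !inE => /orP[/orP[]|] /eqP->.
  - by rewrite in_setD1 (negPf notZg) andbF.
  - by rewrite in_setD Ug.
  - by rewrite in_setD Og.
have oQ : #|Q| = p.+2.
  rewrite cardsU disj cards0 subn0 oC -setUA cardsU1 cards2 !inE negb_or.
  by rewrite neqZO neqZG neqOG /= !addSn prednK.
have Q0 : (set0 \in Q) = (#|G| == (p ^ 3)%N).
  have -> : (set0 \in Q) = (Omega :\: U == set0).
    rewrite in_setU !inE !(eq_sym set0).
    have -> : ('Z(G)^# == set0) = false by apply/negP/negP/set0Pn; exists z.
    have -> : (G :\: Omega == set0) = false.
      by apply/negP/negP/set0Pn; exists h; rewrite in_setD notOh.
    rewrite orbF /=; case: eqP => //= _; apply/andP=> -[_ /rcosetsP[g _ /setP/(_ g)]].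
    by rewrite rcoset_refl inE.
  rewrite setD_eq0 -oG expnSr eqn_pmul2r // -oU eq_sym.
  rewrite (subset_leqif_cards extraspecial_centOhm1_sub).
  by rewrite eqEsubset extraspecial_centOhm1_sub.
rewrite extraspecial_odd_Aut_orbits.
have := cardsD1 set0 Q; rewrite Q0 oQ.
by case: ifP => _; [case | rewrite add0n].
Qed.

End OddOrbits.

(** * The impostor counts *)

Theorem theorem4p10 (gT : finGroupType) (p : nat) (G : {group gT}) :
  prime p -> p.-group G -> extraspecial G ->
  (p = 2 ->
     (G \isog 'Q_8 -> num_impostors_is G 1) /\
     (~ G \isog 'Q_8 -> num_impostors_is G 5)) /\
  (odd p ->
     (exponent G = p -> num_impostors_is G 1) /\
     (exponent G = (p ^ 2)%N -> #|G| = (p ^ 3)%N ->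
        num_impostors_is G (2 ^ p.+1 - 3)) /\
     (exponent G = (p ^ 2)%N -> (p ^ 3 < #|G|)%N ->
        num_impostors_is G (2 ^ p.+2 - 3))).
Proof.
move=> _ pG esG; have H := num_impostors_extraspecial pG esG.
split=> [p2|p_odd].
  rewrite p2 in pG; rewrite (card_extraspecial2_orbits pG esG) in H.
  by case: ifP H => [_|isoG] H; split=> // /negP.
split=> [expG|].
  by rewrite (card_extraspecial_odd_orbits_exp pG esG p_odd expG) in H.
split=> expG oG; rewrite (card_extraspecial_odd_orbits pG esG p_odd expG) in H.
  by rewrite oG eqxx in H.
by rewrite gtn_eqF in H.
Qed.
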